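(* Let $P$ be a simple polyhedron and let $\mathcal{B}$ be a $P$-building set. Then there exists a $P$-nestohedron of $\mathcal{B}$ obtained by listing the elements $\mathcal{B}=\{S_1,\dots,S_k\}$ such that $|S_i|\ge|S_{i+1}|$ for all $i=1,\dots,k-1$, and repeatedly truncating the faces $F_{S_1},\dots,F_{S_k}$ of $P$ in this order.
   Context: A polyhedron is an intersection of finitely many closed halfspaces in $\mathbb{R}^n$; a full-dimensional polyhedron is simple if every nonempty codimension-$k$ face is contained in exactly $k$ facets. Let $\{F_s\mid s\in\mathcal{S}\}$ be the set of facets of the simple full-dimensional polyhedron $P$, and for $I\subseteq\mathcal{S}$ let $F_I=\bigcap_{s\in I}F_s$. The dual simplicial complex $\Delta(P)$ is the set of $I\subseteq\mathcal{S}$ with $F_I\neq\emptyset$. A $P$-building set is a set $\mathcal{B}$ of nonempty faces of $\Delta=\Delta(P)$ such that $\{s\}\in\mathcal{B}$ for every $s\in\mathcal{S}$, and whenever $S_1,S_2\in\mathcal{B}$, $S_1\cap S_2\neq\emptyset$ and $S_1\cup S_2\in\Delta$, then $S_1\cup S_2\in\mathcal{B}$. A subset $N\subseteq\mathcal{B}$ is nested if for any pairwise incomparable $x_1,\dots,x_t\in N$, $t\ge2$, the union $x_1\cup\cdots\cup x_t$ is in $\Delta$ and not in $\mathcal{B}$. The nested complex of $\mathcal{B}$ is the simplicial complex of all nested subsets of $\mathcal{B}$. A $P$-nestohedron of $\mathcal{B}$ is a simple polyhedron whose dual simplicial complex is isomorphic to the nested complex of $\mathcal{B}$. Truncation: let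 $Q$ be a polyhedron with face $F$ and consider an inequality $ax\le b$, with $H=\{ax=b\}$, $H_{\le}=\{ax\le b\}$, $H_>=\{ax>b\}$, $H_<=\{ax<b\}$. The inequality truncates $Q$ at $F$ if $F\subset H_>$; every face $F'$ of $Q$ with $F'\cap F\neq\emptyset$ and $F'\not\subseteq F$ satisfies $H\cap F'\neq\emptyset$; and every face $F'$ of $Q$ with $F'\cap F=\emptyset$ satisfies $F'\subset H_<$. The truncation of $Q$ at $F$ is then $Q\cap H_{\le}$. In the repeated truncation, $Q_0=P$ and $Q_i$ is a truncation of $Q_{i-1}$ at its face corresponding to $F_{S_i}$, namely $F_{S_i}\cap Q_{i-1}$ (the intersection of those facets of $Q_{i-1}$ that lie in the facets $F_s$ of $P$, $s\in S_i$). *)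

(* Defs.v *)
From HB Require Import structures.
From mathcomp Require Import all_boot all_order all_algebra.
From mathcomp Require Import boolp classical_sets functions cardinality reals.

Set Implicit Arguments.
Unset Strict Implicit.
Unset Printing Implicit Defensive.

Import Order.TTheory GRing.Theory Num.Theory.

Local Open Scope classical_set_scope.
Local Open Scope ring_scope.

Section Polyhedra.
Context {R : realType} {n : nat}.
Implicit Types (P Q F : set 'rV[R]_n) (a : 'cV[R]_n) (b : R).

(* Points are row vectors, coefficient vectors are columns: [a x] is [x *m a]. *)
Definition hyperplane a b : set 'rV[R]_n := [set x | (x *m a) 0 0 = b].
Definition halfspace_le a b : set 'rV[R]_n := [set x | (x *m a) 0 0 <= b].
Definition halfspace_lt a b : set 'rV[R]_n := [set x | (x *m a) 0 0 < b].
Definition halfspace_gt a b : set 'rV[R]_n := [set x | (x *m a) 0 0 > b].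

Definition polyhedron P : Prop :=
  exists (m : nat) (a : 'I_m -> 'cV[R]_n) (b : 'I_m -> R),
    (forall j, a j != 0) /\ P = \bigcap_(j in setT) halfspace_le (a j) (b j).

(* [a = 0] is allowed, so that [P] and [set0] are faces of [P]. *)
Definition face P F : Prop :=
  exists a b, P `<=` halfspace_le a b /\ F = P `&` hyperplane a b.

(* The affine hull of [X] is [x + V], of dimension [d]; false for [X] empty. *)
Definition has_dim (X : set 'rV[R]_n) (d : nat) : Prop :=
  exists (x : 'rV[R]_n) (V : {vspace 'rV[R]_n}),
    [/\ X x,
        forall y, X y -> y - x \in V,
        forall W : {vspace 'rV[R]_n},
          (forall y, X y -> y - x \in W) -> (V <= W)%VS
      & \dim V = d].

Definition has_codim (X : set 'rV[R]_n) (k : nat) : Prop :=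
  exists2 d, has_dim X d & (d + k = n)%N.

Definition full_dimensional P : Prop := has_dim P n.

Definition facets P : set (set 'rV[R]_n) :=
  [set F | face P F /\ has_codim F 1].

Definition simple_polyhedron P : Prop :=
  [/\ polyhedron P,
      full_dimensional P
    & forall F k, face P F -> F !=set0 -> has_codim F k ->
        ([set G | facets P G /\ F `<=` G] #= `I_k)%card].

Definition facet_indexing P (S : finType) (F : S -> set 'rV[R]_n) : Prop :=
  set_bij setT (facets P) F.

(* The intersection with [P] makes the empty index set give [P]. *)
Definition face_of P (S : finType) (F : S -> set 'rV[R]_n) (I : {set S}) :
    set 'rV[R]_n :=
  P `&` \bigcap_(s in [set` I]) F s.

Definition dual_complex P (S : finType) (F : S -> set 'rV[R]_n) :
    set {set S} :=
  [set I | face_of P F I !=set0].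

Definition truncates Q F a b : Prop :=
  [/\ F `<=` halfspace_gt a b,
      forall F', face Q F' -> F' `&` F !=set0 -> ~ (F' `<=` F) ->
        hyperplane a b `&` F' !=set0
    & forall F', face Q F' -> F' `&` F = set0 -> F' `<=` halfspace_lt a b].

Definition is_truncation Q F Q' : Prop :=
  [/\ polyhedron Q, face Q F, F !=set0
    & exists a b, truncates Q F a b /\ Q' = Q `&` halfspace_le a b].

End Polyhedra.

(* An abstract simplicial complex is given by its set of simplices. *)
Definition vertices (V : finType) (K : set {set V}) : set V :=
  \bigcup_(I in K) [set` I].

Definition complex_iso (V W : finType) (K : set {set V}) (L : set {set W}) :
    Prop :=
  exists f : V -> W,
    set_bij (vertices K) (vertices L) f /\
    forall I : {set V}, [set` I] `<=` vertices K -> (K I <-> L (f @: I)).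

Section Nested.
Context {S : finType}.
Implicit Types (D : set {set S}) (B N : {set {set S}}).

Definition building_set D B : Prop :=
  [/\ forall X, X \in B -> X != finset.set0 /\ D X,
      forall s : S, [set s]%SET \in B
    & forall X Y, X \in B -> Y \in B -> X :&: Y != finset.set0 ->
        D (X :|: Y) -> X :|: Y \in B].

(* Pairwise incomparable elements are distinct, so a family
   [x_1, ..., x_t] of them is given by the set [A] of its members. *)
Definition nested D B N : Prop :=
  N \subset B /\
  forall A : {set {set S}}, A \subset N -> (2 <= #|A|)%N ->
    {in A &, forall x y : {set S}, x != y -> ~~ (x \subset y)} ->
    D (finset.cover A) /\ finset.cover A \notin B.

Definition nested_complex D B : set {set {set S}} := [set N | nested D B N].

End Nested.

(* [D] is the dual complex of the polyhedron whose building set is [B]. *)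
Definition nestohedron (R : realType) (n : nat) (S : finType)
    (D : set {set S}) (B : {set {set S}}) (Q : set 'rV[R]_n) : Prop :=
  simple_polyhedron Q /\
  exists (T : finType) (G : T -> set 'rV[R]_n),
    facet_indexing Q G /\ complex_iso (dual_complex Q G) (nested_complex D B).

(* Main.v *)
(* Let l_s >= 0 be the slack of the facet inequality of F_s, and h_X the sum of l_s
   over s in X. On P, h_X is nonnegative and vanishes exactly on F_X, so for a small
   enough eps_X > 0 the inequality h_X >= eps_X truncates the face. Choose the
   eps_X successively, each much smaller than the previous ones; the final
   polyhedron is Q = {h_X >= eps_X, X in B}. If the constraints of N are tight at a
   point of Q and X_1, ..., X_t in N are incomparable with union U, then
   h_U <= eps_X1 + ... + eps_Xt, which is less than eps_U if U is in B, and less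
   than min_P h_U if U is not in Delta; so N is nested. Conversely, for nested N one
   distributes the values eps_X over the l_s, s in the union U of N, so that
   h_X = eps_X on N and h_Z >= eps_Z for all Z in B contained in U, and realizes
   these l_s at a point near F_U, where they are independent.
   P is simple exactly when the constraints tight at any of its points are linearly
   independent, and this passes to Q because nested incidence matrices are
   unitriangular. *)

Require Import Defs.
From HB Require Import structures.
From mathcomp Require Import all_boot all_order all_algebra.
From mathcomp Require Import boolp classical_sets functions cardinality reals.
From mathcomp Require Import ring lra.

Set Implicit Arguments.
Unset Strict Implicit.
Unset Printing Implicit Defensive.

Import Order.TTheory GRing.Theory Num.Theory.

Local Open Scope classical_set_scope.
Local Open Scope ring_scope.

(** * Systems of linear inequalities *)

(** Conditions are stated for all [e] below a threshold, not at one value, so that finitely many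
    thresholds combine into their minimum. *)
Lemma exists_pos_fin (R : realType) (I : finType) (Q : I -> R -> Prop) :
  (forall i, exists2 e0, 0 < e0 & forall e, 0 < e <= e0 -> Q i e) ->
  exists2 e0, 0 < e0 & forall e, 0 < e <= e0 -> forall i, Q i e.
Proof.
move=> exQ; have /choice[f fP] i : exists e0, 0 < e0 /\
    forall e, 0 < e <= e0 -> Q i e by have [e0 ? ?] := exQ i; exists e0.
exists (\big[Order.min/1]_i f i).
  by rewrite lt_bigmin// => i _; have [] := fP i.
move=> e /andP[e_gt0 le_e] i; apply: (fP i).2; rewrite e_gt0/=.
by apply: le_trans le_e _; apply: bigmin_le_cond.
Qed.

Lemma has_dim_unique (R : realType) (n : nat) (X : set 'rV[R]_n) d d' :
  has_dim X d -> has_dim X d' -> d = d'.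
Proof.
suff le_dim d1 d2 : has_dim X d1 -> has_dim X d2 -> (d1 <= d2)%N.
  by move=> Xd Xd'; apply/eqP; rewrite eqn_leq !le_dim.
move=> [x [V [Xx XV minV <-]]] [x' [V' [Xx' XV' minV' <-]]].
apply: dimvS; apply: minV => y Xy.
have -> : y - x = (y - x') - (x - x') by rewrite opprB addrA subrK.
by rewrite rpredB ?XV'.
Qed.

Section LinearSystem.
Context {R : realType} {n : nat}.

Definition dot (x : 'rV[R]_n) (a : 'cV[R]_n) : R := (x *m a) 0 0.

Lemma dotDl x y a : dot (x + y) a = dot x a + dot y a.
Proof. by rewrite /dot mulmxDl mxE. Qed.

Lemma dotZl c x a : dot (c *: x) a = c * dot x a.
Proof. by rewrite /dot -scalemxAl mxE. Qed.

Lemma dotNl x a : dot (- x) a = - dot x a.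
Proof. by rewrite /dot mulNmx mxE. Qed.

Lemma dotBl x y a : dot (x - y) a = dot x a - dot y a.
Proof. by rewrite dotDl dotNl. Qed.

Lemma dot0r x : dot x 0 = 0.
Proof. by rewrite /dot mulmx0 mxE. Qed.

Lemma dot_suml (I : Type) (r : seq I) (p : pred I) (v : I -> 'rV[R]_n) a :
  dot (\sum_(i <- r | p i) v i) a = \sum_(i <- r | p i) dot (v i) a.
Proof. by rewrite /dot mulmx_suml summxE. Qed.

Lemma dot_sumr (I : Type) (r : seq I) (p : pred I) x (a : I -> 'cV[R]_n) :
  dot x (\sum_(i <- r | p i) a i) = \sum_(i <- r | p i) dot x (a i).
Proof. by rewrite /dot mulmx_sumr summxE. Qed.

Lemma dot_trmx a : dot a^T a = \sum_i a i 0 ^+ 2.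
Proof. by rewrite /dot mxE; apply: eq_bigr => i _; rewrite mxE expr2. Qed.

Lemma dot_trmx_gt0 a : a != 0 -> 0 < dot a^T a.
Proof.
move=> a_neq0; rewrite dot_trmx lt_def sumr_ge0 ?andbT; last first.
  by move=> i _; rewrite sqr_ge0.
apply: contra_neq a_neq0 => a0; apply/colP => i; rewrite mxE; apply/eqP.
rewrite -sqrf_eq0; apply/eqP; move: a0 => /eqP.
rewrite psumr_eq0; last by move=> j _; rewrite sqr_ge0.
by move=> /allP/(_ i); rewrite mem_index_enum => /(_ isT)/eqP.
Qed.

Context {T : finType} (a : T -> 'cV[R]_n) (b : T -> R).
Implicit Types (x y v : 'rV[R]_n) (t : T) (J U : {set T}).

Definition slack t x : R := b t - dot x (a t).

Definition poly_of : set 'rV[R]_n := [set x | forall t, 0 <= slack t x].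

Definition active x : {set T} := [set t | slack t x == 0]%SET.

(** For [J] the active set of a point, this is the smallest face containing that point. *)
Definition flat J : set 'rV[R]_n :=
  [set x | poly_of x /\ forall t, t \in J -> slack t x = 0].

(* Linear independence of the family [a t], [t \in J], in dual form. *)
Definition indep J : Prop :=
  forall y : T -> R, exists v, forall t, t \in J -> dot v (a t) = y t.

Lemma slack_def t x : slack t x = b t - dot x (a t).
Proof. by []. Qed.

Lemma slack_shift t x v c : slack t (x + c *: v) = slack t x - c * dot v (a t).
Proof. by rewrite /slack dotDl dotZl opprD addrA. Qed.

Lemma slack_mid t x y :
  slack t (2^-1 *: (x + y)) = 2^-1 * slack t x + 2^-1 * slack t y.
Proof. by rewrite /slack dotZl dotDl; field. Qed.

Lemma flat_active x : poly_of x -> flat (active x) x.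
Proof. by move=> Px; split=> // t; rewrite inE => /eqP. Qed.

Lemma flat_activeP x J : flat J x -> J \subset active x.
Proof. by move=> [_ xJ]; apply/fintype.subsetP => t /xJ; rewrite inE => ->. Qed.

Lemma polyhedron_poly_of : (forall t, a t != 0) -> polyhedron poly_of.
Proof.
move=> a_neq0; exists #|T|, (a \o enum_val), (b \o enum_val); split=> [j|].
  exact: a_neq0.
apply/seteqP; split=> x Px.
  by move=> j _; rewrite /halfspace_le /= -subr_ge0; exact: Px.
move=> t; rewrite /slack subr_ge0.
by have := Px (enum_rank t) I; rewrite /halfspace_le /= enum_rankK.
Qed.

Lemma poly_of_move x v : poly_of x ->
  (forall t, t \in active x -> dot v (a t) <= 0) ->
  exists2 e0, 0 < e0 & forall e, 0 < e <= e0 -> poly_of (x + e *: v).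
Proof.
move=> Px vx; apply: exists_pos_fin => t.
have [tx|tx] := boolP (t \in active x).
  exists 1 => // e /andP[e_gt0 _]; rewrite slack_shift.
  have := vx t tx; have := Px t; nra.
have s_gt0 : 0 < slack t x.
  by rewrite lt_def Px andbT; move: tx; rewrite inE.
(* The [+ 1] keeps the denominator positive when [v] is orthogonal to [a t]. *)
exists (slack t x / (`|dot v (a t)| + 1)).
  by rewrite divr_gt0// ltr_wpDl.
move=> e /andP[e_gt0]; rewrite ler_pdivlMr ?ltr_wpDl// slack_shift.
have := ler_norm (dot v (a t)); nra.
Qed.

Definition evals J (v : 'rV[R]_n) : 'rV[R]_#|J| :=
  \row_i dot v (a (enum_val i)).

Lemma evals_is_linear J : linear (evals J).
Proof. by move=> c v w; apply/rowP => i; rewrite !mxE dotDl dotZl. Qed.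

HB.instance Definition _ J :=
  GRing.isLinear.Build R 'rV[R]_n 'rV[R]_#|J| _ (evals J) (evals_is_linear J).

Definition kernel J : {vspace 'rV[R]_n} := lker (linfun (evals J)).

Lemma kernelP J v :
  reflect (forall t, t \in J -> dot v (a t) = 0) (v \in kernel J).
Proof.
rewrite memv_ker lfunE /=; apply: (iffP eqP) => [v0 t tJ|v0].
  by have /rowP/(_ (enum_rank_in tJ t)) := v0; rewrite !mxE enum_rankK_in.
by apply/rowP => i; rewrite !mxE v0// enum_valP.
Qed.

(** Independence in dual form is surjectivity of [evals J], so this is the rank-nullity formula. *)
Lemma indepP J : reflect (indep J) (\dim (kernel J) + #|J| == n)%N.
Proof.
set f := linfun (evals J).
have dimE : (\dim (kernel J) + \dim (limg f) = n)%N.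
  by have := limg_ker_dim f fullv; rewrite capfv dimvf /dim /= mul1n.
have -> : (\dim (kernel J) + #|J| == n)%N = (#|J| == \dim (limg f)).
  by have := eqn_add2l (\dim (kernel J)) #|J| (\dim (limg f)); rewrite dimE.
have dimJ : \dim {: 'rV[R]_#|J|} = #|J| by rewrite dimvf /dim /= mul1n.
rewrite -[X in X == _]dimJ eq_sym; apply: (iffP idP) => [dimf y|indJ].
  have imf : limg f = fullv.
    by apply/eqP; rewrite eqEdim subvf (eqP dimf) leqnn.
  have /memv_imgP[v _ yv] : (\row_i y (enum_val i) : 'rV[R]_#|J|) \in limg f.
    by rewrite imf memvf.
  exists v => t tJ; have := congr1 (fun u : 'rV[R]_#|J| => u 0 (enum_rank_in tJ t)) yv.
  by rewrite lfunE !mxE enum_rankK_in.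
suff -> : limg f = fullv by [].
apply/eqP; rewrite eqEsubv subvf /=; apply/subvP => w _.
have wE : exists y : T -> R, w = \row_i y (enum_val i).
  have [J0|[t0 t0J]] := set_0Vmem J.
    exists (fun=> 0); apply/rowP => i; have := enum_valP i.
    by rewrite [in X in _ \in X]J0 inE.
  exists (fun t => w 0 (enum_rank_in t0J t)); apply/rowP => i.
  by rewrite mxE enum_valK_in.
have [y ->] := wE; have [v vy] := indJ y; apply/memv_imgP; exists v.
  exact: memvf.
by rewrite lfunE /=; apply/rowP => i; rewrite !mxE vy// enum_valP.
Qed.

Lemma indepS J U : U \subset J -> indep J -> indep U.
Proof.
move=> /fintype.subsetP sUJ indJ y; have [v vy] := indJ y.
by exists v => t /sUJ; exact: vy.
Qed.

Lemma indep1 t : a t != 0 -> indep [set t]%SET.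
Proof.
move=> a_neq0 y; exists ((y t / dot (a t)^T (a t)) *: (a t)^T) => u.
by rewrite inE => /eqP->; rewrite dotZl divfK// gt_eqF// dot_trmx_gt0.
Qed.

(** Inequalities that are not tight at [x] leave room for a short move along any direction of the
    kernel, so the affine hull of the face is [x + kernel]. *)
Lemma has_dim_flat x : poly_of x ->
  has_dim (flat (active x)) (\dim (kernel (active x))).
Proof.
move=> Px; exists x, (kernel (active x)); split=> //.
- exact: flat_active.
- move=> y [Py yJ]; apply/kernelP => t tJ; have := yJ t tJ.
  move: tJ; rewrite inE dotBl /slack => /eqP; lra.
- move=> W WJ; apply/subvP => v /kernelP v0.
  have [e e_gt0 Pe] : exists2 e0, 0 < e0 &
      forall e, 0 < e <= e0 -> poly_of (x + e *: v).
    by apply: poly_of_move => // t /v0 ->.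
  have : x + e *: v - x \in W.
    apply: WJ; split=> [|t tJ]; first by apply: Pe; rewrite e_gt0 lexx.
    rewrite slack_shift v0// mulr0 subr0; exact: (flat_active Px).2.
  by rewrite addrC addKr => /(rpredZ e^-1); rewrite scalerA mulVf ?gt_eqF// scale1r.
Qed.

(** Take [x] in [F] with the fewest tight inequalities. The midpoint of [x] and any [y] in [F] is
    tight only where both are, so by minimality everything tight at [x] is tight at [y]. *)
Lemma face_flat F : face poly_of F -> F !=set0 ->
  exists2 x, F x & F = flat (active x).
Proof.
move=> [c [d [Pcd FE]]] [x0 Fx0].
have Fe y : F y <-> poly_of y /\ dot y c = d by rewrite FE.
have le_cd y : poly_of y -> dot y c <= d by exact: Pcd.
pose p k := `[< exists2 x, F x & #|active x| = k >].
have exp : exists k, p k by exists #|active x0|; apply/asboolP; exists x0.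
have [k /asboolP[x Fx <-] min_x] := ex_minnP exp; exists x => //.
have [Px xd] := (Fe x).1 Fx.
apply/seteqP; split=> y.
  move=> Fy; have [Py yd] := (Fe y).1 Fy; split=> // t tx; apply/eqP.
  pose z := 2^-1 *: (x + y).
  have Fz : F z.
    apply/Fe; split=> [u|]; last by rewrite dotZl dotDl xd yd; field.
    by rewrite slack_mid; have := Px u; have := Py u; lra.
  have sub_zx : active z \subset active x.
    apply/fintype.subsetP => u; rewrite !inE slack_mid => /eqP.
    by have := Px u; have := Py u => *; apply/eqP; lra.
  have eq_zx : active z = active x.
    apply/eqP; rewrite eqEcard sub_zx min_x//.
    by apply/asboolP; exists z.
  move: (tx); rewrite -eq_zx !inE slack_mid => /eqP.
  by have := Px t; have := Py t => *; apply/eqP; lra.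
move=> [Py yx]; apply/Fe; split=> //; apply/eqP; rewrite eq_le le_cd//=.
(* For the converse, step from [x] away from [y]: were [dot y c < d], this would leave the halfspace
   while staying in the polyhedron. *)
have [e e_gt0 /(_ e)] : exists2 e0, 0 < e0 &
    forall e, 0 < e <= e0 -> poly_of (x + e *: (x - y)).
  apply: poly_of_move => // t tx; rewrite dotBl; have := yx t tx.
  have := (flat_active Px).2 t tx; rewrite /slack; lra.
rewrite e_gt0 lexx => /(_ isT)/le_cd; rewrite dotDl dotZl dotBl xd; nra.
Qed.

End LinearSystem.

(** * Faces, facets and truncations of a polyhedron *)

Section Faces.
Context {R : realType} {n : nat} {T : finType}.
Variables (a : T -> 'cV[R]_n) (b : T -> R).
Implicit Types (x y v : 'rV[R]_n) (c : 'cV[R]_n) (d e : R) (t : T) (J U : {set T}).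

Local Notation slack := (slack a b).
Local Notation P := (poly_of a b).
Local Notation active := (active a b).
Local Notation flat := (flat a b).
Local Notation kernel := (kernel a).
Local Notation indep := (indep a).

(** The sum of the inequalities in [J] is a supporting one: a sum of nonnegative slacks vanishes
    only if each of them does. *)
Lemma flat_face J : face P (flat J).
Proof.
exists (\sum_(t in J) a t), (\sum_(t in J) b t).
have E x : \sum_(t in J) b t - dot x (\sum_(t in J) a t) = \sum_(t in J) slack t x.
  by rewrite dot_sumr sumrB.
split=> [x Px|]; first by rewrite /halfspace_le /= -subr_ge0 [leRHS]E sumr_ge0.
apply/seteqP; split=> x [Px xJ]; split=> //.
  apply/esym/eqP; rewrite -subr_eq0 [X in X == _]E big1//.
move=> t tJ; move/esym/eqP: xJ; rewrite -subr_eq0 [X in X == _]E psumr_eq0//.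
by move=> /allP/(_ t); rewrite mem_index_enum tJ => /(_ isT)/eqP.
Qed.

(** While [c] is not constant along the face of [x], move inside that face so that [c] increases.
    The bound [d] forces a new inequality to become tight, and the active set can only grow finitely
    often. *)
Lemma flat_descent J c d x : (forall y, flat J y -> dot y c < d) -> flat J x ->
  exists2 y, flat J y & dot x c <= dot y c /\
    forall v, v \in kernel (active y) -> dot v c = 0.
Proof.
move=> ltJ; have [k] := ubnP (#|T| - #|active x|); elim: k x => // k IHk x.
rewrite ltnS => le_k Jx; have [Px x0] := Jx.
have [?|] := pselect (forall v, v \in kernel (active x) -> dot v c = 0).
  by exists x.
move=> /existsNP[v /not_implyP[kv /eqP vc]].
wlog vc_gt0 : v kv vc / 0 < dot v c.
  move=> gen; move: (vc); rewrite neq_lt => /orP[vc_lt0|]; last exact: gen.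
  by apply: (gen (- v)); rewrite ?rpredN ?dotNl ?oppr_eq0 ?oppr_gt0.
have v0 := kernelP _ _ _ kv.
have actJ := fintype.subsetP (flat_activeP Jx).
have shift_flat e : P (x + e *: v) -> flat J (x + e *: v).
  move=> Pe; split=> // t tJ.
  by rewrite slack_shift x0// v0 ?mulr0 ?subr0//; exact: actJ.
have [t1 vt1|no_t] := pickP (fun t => 0 < dot v (a t)); last first.
  (* If nothing stops the ray, the point where [c] takes the value [d] still lies in [flat J],
     against the strict bound. *)
  pose e := (d - dot x c) / dot v c.
  have e_gt0 : 0 < e by rewrite divr_gt0// subr_gt0; apply: ltJ.
  have /ltJ : flat J (x + e *: v).
    apply: shift_flat => t; rewrite slack_shift.
    have := Px t; have /negbT := no_t t; rewrite -leNgt; nra.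
  by rewrite dotDl dotZl /e divfK// addrC subrK ltxx.
pose r t := slack t x / dot v (a t).
(* Move along [v] until a new inequality becomes tight. *)
case: (@arg_minP _ _ _ t1 (fun t => 0 < dot v (a t)) r vt1) => t0 vt0 min_t0.
have r_ge0 : 0 <= r t0 by rewrite divr_ge0// ltW.
have Px' : P (x + r t0 *: v).
  move=> t; rewrite slack_shift subr_ge0.
  have [vt|vt] := ltP 0 (dot v (a t)).
    by rewrite -ler_pdivlMr//; apply: min_t0.
  by apply: le_trans (Px t); nra.
have sub_act : active x \proper active (x + r t0 *: v).
  apply/properP; split.
    apply/fintype.subsetP => t tx; rewrite inE slack_shift v0// mulr0 subr0.
    by move: tx; rewrite inE.
  exists t0; first by rewrite inE slack_shift divfK ?subrr// gt_eqF.
  by apply/negP => /v0 vt0'; rewrite vt0' ltxx in vt0.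
have [||y Jy [le_y y0]] := IHk (x + r t0 *: v).
- apply: leq_trans le_k; apply: ltn_sub2l (proper_card sub_act).
  apply: leq_trans (proper_card sub_act) (max_card _).
- exact: shift_flat.
exists y => //; split=> //; apply: le_trans le_y; rewrite dotDl dotZl lerDl.
by rewrite mulr_ge0// ltW.
Qed.

(* A descent stops at a point where the functional is determined by the set of
   vanishing slacks, so only finitely many values compete for the infimum. *)
Lemma flat_gap J c d : (forall x, flat J x -> dot x c < d) ->
  exists2 e0, 0 < e0 & forall e, 0 < e <= e0 ->
    forall x, flat J x -> dot x c <= d - e.
Proof.
move=> ltJ.
have [e0 e0_gt0 e0P] : exists2 e0, 0 < e0 & forall e, 0 < e <= e0 ->
    forall U x, flat J x -> active x = U ->
      (forall v, v \in kernel U -> dot v c = 0) -> dot x c <= d - e.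
  apply: exists_pos_fin => U.
  have [[x0 [Jx0 x0U Uc]]|none] := pselect (exists x, [/\ flat J x, active x = U &
      (forall v, v \in kernel U -> dot v c = 0)]); last first.
    by exists 1 => // e _ x Jx xU Uc; case: none; exists x.
  exists (d - dot x0 c); first by rewrite subr_gt0 ltJ.
  move=> e /andP[_ le_e] x Jx xU _.
  suff : dot (x - x0) c = 0 by rewrite dotBl; lra.
  apply: Uc; apply/kernelP => t tU; rewrite dotBl.
  have := (flat_active Jx0.1).2 t; have := (flat_active Jx.1).2 t.
  rewrite xU x0U  => /(_ tU) + /(_ tU); rewrite !slack_def; lra.
exists e0 => // e le_e x Jx.
have [y Jy [le_xy y0]] := flat_descent ltJ Jx.
exact: le_trans le_xy (e0P e le_e _ y Jy erefl y0).
Qed.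

(** There are finitely many flats. One that has a point strictly below [d] keeps a point below
    [d - e] for small [e]; one that lies entirely below [d] does so by a uniform gap, by
    [flat_gap]. *)
Lemma exists_truncation c d : (forall x, P x -> dot x c <= d) ->
  exists2 e0, 0 < e0 & forall e, 0 < e <= e0 ->
    truncates P (P `&` hyperplane c d) c (d - e).
Proof.
move=> Pcd.
have [e0 e0_gt0 e0P] : exists2 e0, 0 < e0 & forall e, 0 < e <= e0 -> forall J,
    ((exists2 y, flat J y & dot y c < d) ->
       exists2 y, flat J y & dot y c <= d - e) /\
    ((forall x, flat J x -> dot x c < d) ->
       forall x, flat J x -> dot x c < d - e).
  apply: exists_pos_fin => J.
  have [[y Jy yc]|noy] := pselect (exists2 y, flat J y & dot y c < d);
    have [ltJ|ltJ] := pselect (forall x, flat J x -> dot x c < d).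
  - have [e0 e0_gt0 e0P] := flat_gap ltJ.
    (* Half of the gap turns its weak inequality into a strict one. *)
    exists (e0 / 2); first by rewrite divr_gt0.
    move=> e /andP[e_gt0 le_e]; split=> [_|_ x Jx].
      exists y => //; apply: e0P => //; rewrite e_gt0/=; lra.
    by have := e0P e0 _ x Jx; rewrite e0_gt0 lexx => /(_ isT); lra.
  - exists (d - dot y c); first by rewrite subr_gt0.
    by move=> e /andP[_ le_e]; split=> // _; exists y => //; lra.
  - exists 1 => // e _; split=> // _ x Jx; case: noy; exists x => //; exact: ltJ.
  - by exists 1 => // e _; split=> [/noy|/ltJ].
exists e0 => // e le_e; have e_gt0 : 0 < e by case/andP: le_e.
have eP := e0P e le_e; split.
- move=> x [_ /= xd]; rewrite /halfspace_gt /= xd; lra.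
- move=> F' faceF' [x [F'x [Px xd]]] /existsNP[y /not_implyP[F'y nFy]].
  have [z F'z F'E] : exists2 z, F' z & F' = flat (active z).
    by apply: face_flat => //; exists x.
  move: F'x F'y; rewrite F'E => Jx Jy.
  have yc : dot y c < d.
    by rewrite lt_neqAle Pcd ?andbT; [apply/eqP => yd; apply: nFy; split|]; case: Jy.
  have [w Jw wc] := (eP (active z)).1 (ex_intro2 _ _ y Jy yc).
  (* The parameter at which the segment from [x], at level [d], to [w] crosses level [d - e]. *)
  pose r := e / (d - dot w c).
  have dw : 0 < d - dot w c by lra.
  have r01 : 0 <= r <= 1.
    by rewrite divr_ge0 ?(ltW e_gt0) ?(ltW dw)//= ler_pdivrMr// mul1r; lra.
  have slackE t : slack t (x + r *: (w - x)) = (1 - r) * slack t x + r * slack t w.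
    by rewrite slack_shift dotBl !slack_def; ring.
  exists (x + r *: (w - x)); split.
    rewrite /hyperplane /= -/(dot _ _) dotDl dotZl dotBl; move: xd.
    rewrite /hyperplane /= -/(dot _ _) => xd.
    by rewrite xd /r; field; rewrite gt_eqF.
  split=> [t|t tz]; rewrite slackE; last by rewrite Jx.2 ?Jw.2// !mulr0 addr0.
  by have := Jx.1 t; have := Jw.1 t; nra.
- move=> F' faceF' F'0 x F'x.
  have [z F'z F'E] : exists2 z, F' z & F' = flat (active z).
    by apply: face_flat => //; exists x.
  apply: (eP (active z)).2; rewrite -?F'E// => y F'y.
  have Py : P y by move: F'y; rewrite F'E => -[].
  rewrite lt_neqAle Pcd// andbT; apply/eqP => yd.
  by have : (F' `&` (P `&` hyperplane c d)) y by []; rewrite F'0.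
Qed.

(** A dual basis [v] of the normals tight at [x] adjusts their slacks independently. The other
    slacks are positive at [x] and change by at most [e * C t]. *)
Lemma near_flat x U : P x -> indep (active x) -> U \subset active x ->
  exists2 e0, 0 < e0 & forall e, 0 < e <= e0 ->
    forall y : T -> R, (forall t, 0 <= y t <= e) ->
    exists z, (forall t, t \in U -> slack t z = y t) /\
              (forall t, t \notin U -> e <= slack t z).
Proof.
move=> Px indx /fintype.subsetP sUx.
have /choice[v vP] s : exists v, forall t, t \in active x ->
  dot v (a t) = (t == s)%:R := indx (fun t => (t == s)%:R).
pose C t := \sum_(s in active x) `|dot (v s) (a t)|.
have C_ge0 t : 0 <= C t by rewrite sumr_ge0.
have [e0 e0_gt0 e0P] : exists2 e0, 0 < e0 & forall e, 0 < e <= e0 -> forall t,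
    t \notin active x -> e * (1 + C t) <= slack t x.
  apply: exists_pos_fin => t; have [tx|tx] := boolP (t \in active x).
    by exists 1.
  have sl_gt0 : 0 < slack t x by rewrite lt_def Px andbT; move: tx; rewrite inE.
  exists (slack t x / (1 + C t)); first by rewrite divr_gt0// ltr_wpDr.
  by move=> e /andP[_ le_e] _; rewrite -ler_pdivlMr// ltr_wpDr.
exists e0 => // e le_e y ye; have e_gt0 : 0 < e by case/andP: le_e.
(* Inequalities tight at [x] but outside [U] are released to slack exactly [e]. *)
pose u s := if s \in U then y s else e.
have ue s : 0 <= u s <= e by rewrite /u; case: ifP => // _; rewrite lexx ltW.
pose z := x - \sum_(s in active x) u s *: v s.
have slackz t : slack t z = slack t x + \sum_(s in active x) u s * dot (v s) (a t).
  rewrite /z !slack_def dotBl dot_suml opprB addrCA addrC; congr (_ + _).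
  by apply: eq_bigr => s _; rewrite dotZl.
have slackz_in t : t \in active x -> slack t z = u t.
  move=> tx; rewrite slackz (flat_active Px).2// add0r (bigD1 t)//= vP// eqxx mulr1.
  rewrite big1 ?addr0// => s /andP[sx st]; rewrite vP//.
  by rewrite eq_sym (negbTE st) mulr0.
exists z; split=> t tU; first by rewrite slackz_in ?/u ?tU//; exact: sUx.
have [tx|tx] := boolP (t \in active x); first by rewrite slackz_in// /u (negbTE tU).
rewrite slackz; have := e0P e le_e t tx.
suff : - (e * C t) <= \sum_(s in active x) u s * dot (v s) (a t) by lra.
rewrite /C mulr_sumr -sumrN; apply: ler_sum => s _.
have := ue s; have := ler_norm (- dot (v s) (a t)); rewrite normrN.
have := normr_ge0 (dot (v s) (a t)); nra.
Qed.

(** * Irredundant systems, facets and simplicity *)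

Definition irredundant : Prop :=
  [/\ forall t, a t != 0,
      exists2 x, P x & active x = finset.set0
    & forall t, exists2 x, P x & active x = [set t]%SET].

(** With independent tight normals, [near_flat] at [y = 0] gives a point where any chosen subset of
    the tight inequalities, and nothing else, is tight. *)
Lemma indep_irredundant : P !=set0 -> (forall x, P x -> indep (active x)) ->
  (forall t, exists2 x, P x & t \in active x) -> irredundant.
Proof.
move=> [x0 Px0] indP exP.
have exU x U : P x -> U \subset active x -> exists2 z, P z & active z = U.
  move=> Px sUx; have [e e_gt0 /(_ e)] := near_flat Px (indP x Px) sUx.
  rewrite e_gt0 lexx => /(_ isT (fun=> 0))[|z [zU znU]].
    by move=> _; rewrite lexx ltW.
  exists z => [t|].
    have [/zU->//|/znU] := boolP (t \in U); exact/le_trans/ltW.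
  apply/setP => t; rewrite inE; have [/zU->|/znU] := boolP (t \in U).
    exact: eqxx.
  by move=> le_e; apply/negbTE; rewrite gt_eqF// (lt_le_trans e_gt0).
split=> [t||t].
- have [x Px tx] := exP t; have [v /(_ t tx) vt] := indP x Px (fun=> 1).
  by apply/eqP => at0; move/eqP: vt; rewrite at0 dot0r eq_sym oner_eq0.
- by apply: exU Px0 _; rewrite finset.sub0set.
- by have [x Px tx] := exP t; apply: exU Px _; rewrite finset.sub1set.
Qed.

Hypothesis irr : irredundant.

Lemma flat1_inj : injective (fun t => flat [set t]%SET).
Proof.
case: irr => _ _ exw t s tsE; have [w Pw wt] := exw t.
have : flat [set t]%SET w by rewrite -wt; exact: flat_active.
rewrite tsE => -[_ /(_ s)]; rewrite inE eqxx => /(_ isT) ws.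
have : s \in active w by rewrite inE ws.
by rewrite wt inE => /eqP.
Qed.

(** A facet is [flat (active x)] for one of its points [x]. Codimension 1 gives a tight [t], and by
    dimension the kernel of [active x] equals that of [t] alone, so both cut out the same flat. *)
Lemma facetsE : facets P = range (fun t => flat [set t]%SET).
Proof.
case: irr => a_neq0 [p Pp p0] exw.
have dim1 t : (\dim (kernel [set t]%SET) + 1 = n)%N.
  by have /indepP/eqP := indep1 (a_neq0 t); rewrite cards1.
apply/seteqP; split=> [G [faceG [k dimG kn]]|_ [t _ <-]]; last first.
  split; first exact: flat_face.
  exists (\dim (kernel [set t]%SET)) => //.
  by have [w Pw <-] := exw t; exact: has_dim_flat.
have [x Gx GE] : exists2 x, G x & G = flat (active x).
  by apply: face_flat => //; have [x [V [Gx _ _ _]]] := dimG; exists x.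
have Px : P x by move: Gx; rewrite GE => -[].
have kE : k = \dim (kernel (active x)).
  by apply: has_dim_unique dimG _; rewrite GE; exact: has_dim_flat.
have [x0|[t tx]] := set_0Vmem (active x).
  have /indepP/eqP : indep (finset.set0 : {set T}) by move=> y; exists 0 => t; rewrite inE.
  by rewrite cards0 -x0 -kE => /eqP; have := eqn_add2l k 0 1; rewrite kn => ->.
have sker : (kernel (active x) <= kernel [set t]%SET)%VS.
  by apply/subvP => v /kernelP v0; apply/kernelP => s; rewrite inE => /eqP->; exact: v0.
have keq : kernel (active x) = kernel [set t]%SET.
  by apply/eqP; rewrite eqEdim sker -kE -(leq_add2r 1) dim1 kn leqnn.
exists t => //; rewrite GE; apply/seteqP; split=> y [Py y0]; split=> // s.
  move=> sx; have [_ x0] := flat_active Px.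
  have : y - x \in kernel [set t]%SET.
    apply/kernelP => u; rewrite inE => /eqP->; rewrite dotBl.
    by have := y0 t; have := x0 t tx; rewrite inE eqxx !slack_def => + /(_ isT); lra.
  rewrite -keq => /kernelP/(_ s sx); rewrite dotBl.
  by have := x0 s sx; rewrite !slack_def; lra.
by rewrite inE => /eqP->; exact: y0.
Qed.

Lemma facets_containing x : P x ->
  ([set G | facets P G /\ flat (active x) `<=` G] #= `I_#|active x|)%card.
Proof.
move=> Px.
have -> : [set G | facets P G /\ flat (active x) `<=` G] =
    (fun i : 'I_#|active x| => flat [set enum_val i]%SET) @` setT.
  apply/seteqP; split=> [G [+ sG]|_ [i _ <-]]; rewrite facetsE.
    move=> [t _ tG]; have tx : t \in active x.
      have := sG _ (flat_active Px).
      by rewrite -tG => -[_ /(_ t)]; rewrite !inE eqxx => /(_ isT)->.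
    by exists (enum_rank_in tx t); rewrite //= enum_rankK_in.
  split; first by exists (enum_val i).
  by move=> y [Py y0]; split=> // s; rewrite inE => /eqP->; exact/y0/enum_valP.
rewrite (card_eql (inj_card_eq _)) 1?card_eq_sym; first exact: card_II.
by apply: in2W => i j /flat1_inj/enum_val_inj.
Qed.

(** The smallest face at [x] lies in exactly [#|active x|] facets, and its codimension is that of
    the kernel; by [indepP] these agree exactly when the tight normals are independent. *)
Lemma simple_polyhedronE :
  simple_polyhedron P <-> forall x, P x -> indep (active x).
Proof.
case: irr => a_neq0 [p Pp p0] exw; split=> [[_ _ simP] x Px|indP].
  pose k := (n - \dim (kernel (active x)))%N.
  have dimn : (\dim (kernel (active x)) <= n)%N.
    by rewrite (leq_trans (dimvS (subvf _)))// dimvf /dim /= mul1n.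
  have := simP _ k (flat_face (active x)) (ex_intro _ x (flat_active Px)).
  move=> /(_ (ex_intro2 _ _ _ (has_dim_flat Px) (subnKC dimn))).
  rewrite (card_eql (facets_containing Px)) => /card_eq_II kE.
  by apply/indepP; rewrite kE subnKC.
split=> [||F k faceF F0 [d dimF dk]]; first exact: polyhedron_poly_of.
  have flatp : P = flat (active p).
    by rewrite p0; apply/seteqP; split=> x; [split=> // t; rewrite inE|case].
  have /indepP := indP p Pp; rewrite {2}p0 cards0 addn0 => /eqP kn.
  by rewrite /full_dimensional flatp -[X in has_dim _ X]kn; exact: has_dim_flat.
have [x Fx FE] := face_flat faceF F0.
have Px : P x by move: Fx; rewrite FE => -[].
have dE : d = \dim (kernel (active x)).
  by apply: has_dim_unique dimF _; rewrite FE; exact: has_dim_flat.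
have -> : k = #|active x|.
  have /indepP/eqP := indP x Px; rewrite -dE -[X in _ = X]dk => /eqP.
  by rewrite eqn_add2l => /eqP.
by rewrite FE; exact: facets_containing.
Qed.

End Faces.

(** Each inequality is strict somewhere, since otherwise the polyhedron would lie in a hyperplane;
    averaging such points makes all of them strict. *)
Lemma interior_point (R : realType) (n : nat) (T : finType)
    (a : T -> 'cV[R]_n) (b : T -> R) :
  (forall t, a t != 0) -> full_dimensional (poly_of a b) ->
  exists2 p, poly_of a b p & active a b p = finset.set0.
Proof.
move=> a_neq0 [x [V [Px PV minV dimV]]].
have Vfull : V = fullv.
  by apply/eqP; rewrite eqEdim subvf dimvf /dim /= mul1n dimV leqnn.
have /choice[y yP] t : exists y, poly_of a b y /\ 0 < slack a b t y.
  apply: contrapT => /forallNP noy.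
  have /minV : forall y, poly_of a b y -> y - x \in kernel a [set t]%SET.
    have eq0 y : poly_of a b y -> slack a b t y = 0.
      move=> Py; apply/eqP; rewrite eq_le Py andbT leNgt.
      by apply/negP => sl; apply: (noy y).
    move=> y Py; apply/kernelP => s; rewrite inE => /eqP->.
    by have := eq0 y Py; have := eq0 x Px; rewrite /slack dotBl; lra.
  rewrite Vfull => /subvP/(_ (a t)^T (memvf _))/kernelP/(_ t).
  rewrite inE eqxx => /(_ isT) at0.
  by have := dot_trmx_gt0 (a_neq0 t); rewrite at0 ltxx.
(* [N] counts the averaged points: one for each inequality, and [x], which covers the case of no
   inequalities. *)
have [N N_gt0 NE] : exists2 N : R, 0 < N & #|T|%:R = N - 1.
  by exists #|T|.+1%:R; rewrite ?ltr0n// -natr1 addrK.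
pose p := N^-1 *: (x + \sum_t y t).
have slackp t : slack a b t p = N^-1 * (slack a b t x + \sum_u slack a b t (y u)).
  rewrite /slack /p dotZl dotDl dot_suml sumrB sumr_const.
  by rewrite -mulr_natl NE; field; rewrite gt_eqF.
have p_gt0 t : 0 < slack a b t p.
  rewrite slackp mulr_gt0 ?invr_gt0// ltr_wpDl//.
  rewrite (bigD1 t)//= ltr_pwDl ?(yP t).2// sumr_ge0// => u _.
  exact: (yP u).1.
exists p => [t|]; first exact: ltW.
by apply/setP => t; rewrite !inE gt_eqF.
Qed.

(** Keep a minimal subsystem defining [P]. Dropping [t] then admits a point [z] violating only [t],
    and the segment from an interior point to [z] meets the hyperplane of [t] where all other
    inequalities are strict. *)
Lemma polyhedron_irredundant (R : realType) (n : nat) (P : set 'rV[R]_n) :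
  polyhedron P -> full_dimensional P ->
  exists (T : finType) (a : T -> 'cV[R]_n) (b : T -> R),
    irredundant a b /\ P = poly_of a b.
Proof.
move=> [m [a [b [a_neq0 PE]]]] fullP.
pose pS (M : {set 'I_m}) := [set x | forall j, j \in M -> 0 <= slack a b j x].
pose isP (M : {set 'I_m}) := `[< P = pS M >].
have PT : isP [set: 'I_m]%SET.
  apply/asboolP; rewrite PE; apply/seteqP; split=> x Px j.
    by move=> _; rewrite /slack subr_ge0; exact: Px.
  by move=> _; have := Px j (finset.in_setT j); rewrite /slack subr_ge0.
have [M /minsetP[/asboolP PM minM] _] := minset_exists PT.
pose T := {j | j \in M}; pose a' (t : T) := a (val t); pose b' (t : T) := b (val t).
have PE' : P = poly_of a' b'.
  rewrite PM; apply/seteqP; split=> x Px.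
    by move=> t; exact: Px (valP t).
  by move=> j jM; exact: (Px (exist _ j jM)).
exists T, a', b'; split=> //.
have a'_neq0 t : a' t != 0 by exact: a_neq0.
have [p Pp p0] : exists2 p, poly_of a' b' p & active a' b' p = finset.set0.
  by apply: interior_point => //; rewrite -PE'.
have p_gt0 t : 0 < slack a' b' t p.
  rewrite lt_def Pp andbT; have : t \notin active a' b' p by rewrite p0 inE.
  by rewrite inE.
split=> [//||t]; first by exists p.
have [z zt z_ge0] : exists2 z, slack a' b' t z < 0 &
    forall u, u != t -> 0 <= slack a' b' u z.
  apply: contrapT => noz.
  have : isP (M :\ val t).
    apply/asboolP; rewrite PE'; apply/seteqP; split=> x Px.
      by move=> j /setD1P[_ jM]; exact: (Px (exist _ j jM)).
    move=> u; have ut_ge0 (v : T) : v != t -> 0 <= slack a' b' v x.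
      by move=> vt; apply: (Px (val v)); rewrite in_setD1 (valP v) andbT.
    have [->|/ut_ge0//] := eqVneq u t.
    by rewrite leNgt; apply/negP => xt; apply: noz; exists x.
  move=> /minM/(_ (subD1set _ _))/setP/(_ (val t)).
  by rewrite in_setD1 eqxx (valP t).
pose r := slack a' b' t p / (slack a' b' t p - slack a' b' t z).
have pt := p_gt0 t.
have d_gt0 : 0 < slack a' b' t p - slack a' b' t z by lra.
have r_gt0 : 0 < r by rewrite divr_gt0.
have r_lt1 : r < 1 by rewrite ltr_pdivrMr// mul1r; lra.
have slackE u : slack a' b' u (p + r *: (z - p)) =
    (1 - r) * slack a' b' u p + r * slack a' b' u z.
  by rewrite slack_shift dotBl /slack; ring.
have w0 : slack a' b' t (p + r *: (z - p)) = 0.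
  by rewrite slackE /r; field; rewrite gt_eqF.
have w_gt0 u : u != t -> 0 < slack a' b' u (p + r *: (z - p)).
  by move=> ut; rewrite slackE; have := p_gt0 u; have := z_ge0 u ut; nra.
exists (p + r *: (z - p)).
  by move=> u; have [->|/w_gt0/ltW//] := eqVneq u t; rewrite w0.
apply/setP => u; rewrite !inE; have [->|ut] := eqVneq u t; first by rewrite w0 eqxx.
by rewrite gt_eqF// w_gt0.
Qed.

(** In an irredundant system the inequalities correspond bijectively to the facets, so they can be
    reindexed by [S]. *)
Lemma facet_system (R : realType) (n : nat) (P : set 'rV[R]_n) (S : finType)
    (F : S -> set 'rV[R]_n) :
  simple_polyhedron P -> facet_indexing P F ->
  exists (a : S -> 'cV[R]_n) (b : S -> R),
    [/\ P = poly_of a b, forall s, F s = flat a b [set s]%SET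
      & forall x, P x -> indep a (active a b x)].
Proof.
move=> simP [Fto Finj Fsurj]; have [polyP fullP _] := simP.
have [T [a [b [irr PE]]]] := polyhedron_irredundant polyP fullP.
have facP : facets P = range (fun t => flat a b [set t]%SET).
  by rewrite PE; exact: facetsE.
have /choice[j jP] s : exists t, F s = flat a b [set t]%SET.
  have : facets P (F s) by exact: Fto.
  by rewrite facP => -[t _ <-]; exists t.
have j_inj : injective j.
  by move=> s s' jss'; apply: Finj; rewrite ?inE// !jP jss'.
have j_surj t : exists s, j s = t.
  have : facets P (flat a b [set t]%SET) by rewrite facP; exists t.
  by move=> /Fsurj[s _]; rewrite jP => /(flat1_inj irr) <-; exists s.
have PE' : poly_of a b = poly_of (a \o j) (b \o j).
  apply/seteqP; split=> x Px; first by move=> s; exact: (Px (j s)).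
  by move=> t; have [s <-] := j_surj t; exact: (Px s).
exists (a \o j), (b \o j); split=> [|s|x Px].
- by rewrite PE.
- rewrite jP /flat -PE'; apply/seteqP; split=> x [Px x0]; split=> // t.
    by rewrite inE => /eqP->; apply: (x0 (j s)); rewrite inE.
  by rewrite inE => /eqP->; apply: (x0 s); rewrite inE.
- have indx : indep a (active a b x).
    by move: simP Px; rewrite PE => /(simple_polyhedronE irr); apply.
  move=> y; have /choice[i iP] := j_surj.
  have [v vP] := indx (y \o i); exists v => s; rewrite inE => sx.
  have -> : y s = (y \o i) (j s) by rewrite /=; congr y; apply: j_inj; rewrite iP.
  by apply: vP; rewrite inE.
Qed.

(** * Nested sets *)

Section NestedSets.
Context {S : finType} (D : set {set S}) (B : {set {set S}}).
Hypotheses (D0 : D finset.set0) (hB : building_set D B).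
Hypothesis DS : forall X Y : {set S}, X \subset Y -> D Y -> D X.
Implicit Types (X Y Z : {set S}) (A M N : {set {set S}}).

Lemma nestedS M N : M \subset N -> nested D B N -> nested D B M.
Proof.
move=> sMN [sNB nestN]; split=> [|A sAM]; first exact: fintype.subset_trans sNB.
by apply: nestN; exact: fintype.subset_trans sMN.
Qed.

Lemma sub_cover X N : X \in N -> X \subset finset.cover N.
Proof. by move=> XN; rewrite /finset.cover (finset.bigcup_max X). Qed.

Lemma maxset_antichain N X Y : maxset (mem N) X -> maxset (mem N) Y ->
  X != Y -> ~~ (X \subset Y).
Proof.
move=> /maxsetP[_ maxX] /maxsetP[NY _]; apply: contraNN => sXY.
by rewrite (maxX Y).
Qed.

(** The maximal elements of [N] have the same union and form an antichain. Nestedness applies if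
    there are at least two, the building set axiom if there is one, [D0] if there is none. *)
Lemma nested_cover N : nested D B N -> D (finset.cover N).
Proof.
move=> [sNB nestN]; pose A := [set X | maxset (mem N) X]%SET.
have coverA : finset.cover N = finset.cover A.
  apply/eqP; rewrite finset.eqEsubset; apply/andP; split; apply/finset.bigcupsP => X.
    move=> XN; have [Y maxY sXY] := maxset_exists (P := mem N) XN.
    by apply: fintype.subset_trans sXY _; apply: sub_cover; rewrite inE.
  by rewrite inE => /maxsetP[XN _]; exact: sub_cover.
have sAN : A \subset N by apply/fintype.subsetP => X; rewrite inE => /maxsetP[].
have [leA|] := leqP 2 #|A|.
  rewrite coverA; apply: (nestN A sAN leA _).1 => X Y; rewrite !inE.
  exact: maxset_antichain.
rewrite coverA ltnS leq_eqVlt ltnS leqn0 cards_eq0 => /orP[/cards1P[X AX]|/eqP->].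
  rewrite AX /finset.cover big_set1; case: hB => BD _ _; apply: (BD X _).2.
  by apply: (fintype.subsetP sNB); apply: (fintype.subsetP sAN); rewrite AX inE.
by rewrite /finset.cover big_set0.
Qed.

Lemma nested_absorb N X Z : nested D B N -> maxset (mem N) X -> Z \in B ->
  Z \subset finset.cover N -> Z :&: X != finset.set0 -> Z \subset X.
Proof.
case: hB => BD _ BU nestN maxX ZB sZ ZX.
have DN := nested_cover nestN; have [sNB antiN] := nestN.
(* Adding to [Z], one by one, the maximal elements of [N] that it meets stays in
   [B]; so the union of these elements is in [B], hence there is only one. *)
pose A := [set Y | maxset (mem N) Y & Z :&: Y != finset.set0]%SET.
have AN Y : Y \in A -> Y \in N by rewrite inE => /andP[/maxsetP[]].
have coverAB : Z :|: finset.cover A \in B.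
  rewrite /finset.cover -big_enum.
  have : {subset enum A <= A} by move=> Y; rewrite mem_enum.
  elim: (enum A) => [|Y r IHr] sub_r; first by rewrite big_nil finset.setU0.
  have YA : Y \in A by apply: sub_r; rewrite inE eqxx.
  have rA : {subset r <= A} by move=> U Ur; apply: sub_r; rewrite inE Ur orbT.
  rewrite big_cons finset.setUCA; apply: BU.
  - exact/(fintype.subsetP sNB)/AN.
  - exact: IHr.
  - move: YA; rewrite inE => /andP[_ /set0Pn[s /finset.setIP[sZ' sY]]].
    by apply/set0Pn; exists s; rewrite !inE sY sZ'.
  - apply: DS DN; rewrite !finset.subUset sZ sub_cover ?AN//= big_seq.
    elim/big_ind: _ => [|U V sU sV|U /rA/AN]; first exact: finset.sub0set.
      by rewrite finset.subUset sU.
    exact: sub_cover.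
have sZA : Z \subset finset.cover A.
  apply/fintype.subsetP => s sZ'; have /finset.bigcupP[Y YN sY] := fintype.subsetP sZ s sZ'.
  have [U maxU sYU] := maxset_exists (P := mem N) YN.
  apply/finset.bigcupP; exists U; last exact: (fintype.subsetP sYU).
  by rewrite inE maxU; apply/set0Pn; exists s; rewrite inE sZ' (fintype.subsetP sYU).
rewrite (finset.setUidPr sZA) in coverAB.
have XA : X \in A by rewrite inE maxX.
have [leA|] := leqP 2 #|A|.
  have sAN : A \subset N by apply/fintype.subsetP => Y /AN.
  have [|_ /negP//] := antiN A sAN leA.
  move=> U V; rewrite !inE => /andP[maxU _] /andP[maxV _].
  exact: maxset_antichain maxU maxV.
rewrite ltnS => /card_le1_eqP eqA.
apply: fintype.subset_trans sZA _; apply/finset.bigcupsP => Y YA.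
by rewrite (eqA _ _ YA XA).
Qed.

(** Remove an element [X] of largest cardinality. If the others covered [X], [nested_absorb] would
    place it inside one of them, against the choice of [X]; hence the private point [s]. *)
Lemma nested_ind (Q : {set {set S}} -> Prop) :
  Q finset.set0 ->
  (forall N X s, nested D B N -> X \in N -> s \in X ->
     s \notin finset.cover (N :\ X) ->
     (forall Z, Z \in B -> Z \subset finset.cover N ->
        Z :&: X != finset.set0 -> Z \subset X) ->
     Q (N :\ X) -> Q N) ->
  forall N, nested D B N -> Q N.
Proof.
move=> Q0 Qstep N; have [k] := ubnP #|N|; elim: k N => // k IHk N leN nestN.
have [->//|[X0 X0N]] := set_0Vmem N.
case: (@arg_maxnP _ X0 (mem N) (fun X => #|X|) X0N) => X; rewrite /= => XN maxX.
have sN'N := subD1set N X.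
have nestN' := nestedS sN'N nestN.
have [BD _ _] := hB.
have XB : X \in B by apply: (fintype.subsetP nestN.1).
have [s sX sN'] : exists2 s, s \in X & s \notin finset.cover (N :\ X).
  apply/fintype.subsetPn; apply/negP => sXN'.
  have [/set0Pn[s sX] _] := BD X XB.
  have /finset.bigcupP[Y YN' sY] := fintype.subsetP sXN' s sX.
  have [U maxU sYU] := maxset_exists (P := mem (N :\ X)) YN'.
  have sXU : X \subset U.
    apply: nested_absorb nestN' maxU XB sXN' _.
    by apply/set0Pn; exists s; rewrite inE sX (fintype.subsetP sYU).
  have /maxsetP[/setD1P[UX UN] _] := maxU.
  by case/negP: UX; rewrite eq_sym eqEcard sXU; exact: maxX.
apply: (Qstep N X s) => //.
  move=> Z ZB sZ; apply: nested_absorb nestN _ ZB sZ.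
  apply/maxsetP; split=> // Y YN sXY; apply/eqP; rewrite eq_sym eqEcard sXY.
  exact: maxX.
apply: IHk => //; rewrite -ltnS; apply: leq_trans leN.
by rewrite ltnS [leqRHS](cardsD1 X) (_ : X \in N).
Qed.

(* The incidence matrix of a nested set is unitriangular: listing its elements by
   decreasing size, each one contains a point that no later one contains. *)
Lemma nested_unimodular (R : realType) N (y : {set S} -> R) : nested D B N ->
  exists u : S -> R, forall X, X \in N -> \sum_(s in X) u s = y X.
Proof.
move: N; apply: nested_ind => [|N X s nestN XN sX sN' _ [u uN']].
  by exists (fun=> 0) => X; rewrite inE.
(* Only the value at [s] is changed; as [s] lies in no other element of [N], the other equations
   persist. *)
exists (fun t => if t == s then y X - \sum_(t in X :\ s) u t else u t) => Y YN.
have [->|YX] := eqVneq Y X.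
  rewrite (big_setD1 s)//= eqxx [X in _ + X](eq_bigr u) ?subrK//.
  by move=> t /setD1P[/negbTE->].
have YN' : Y \in N :\ X by rewrite in_setD1 YX.
rewrite -(uN' Y)//; apply: eq_bigr => t tY; case: eqVneq => // ts.
by case/negP: sN'; rewrite -ts (fintype.subsetP (sub_cover YN')).
Qed.

(** Weights on the part [C] covered before [X] are kept, so the bounds for sets inside [C] persist.
    Any other [Z] lies in [X] and contains a new point, whose weight alone suffices if [Z] is
    smaller than [X]. *)
Lemma nested_weights (R : realType) (eps : {set S} -> R) N :
  (forall X, X \in B -> 0 < eps X) ->
  (forall X Y, X \in B -> Y \in B -> (#|Y| < #|X|)%N ->
     #|S|%:R * eps Y <= eps X) ->
  nested D B N ->
  exists u : S -> R,
    [/\ forall s, 0 <= u s,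
        forall X, X \in N -> \sum_(s in X) u s = eps X
      & forall Z, Z \in B -> Z \subset finset.cover N ->
          eps Z <= \sum_(s in Z) u s].
Proof.
move=> eps_gt0 epsS; have [BD _ _] := hB; move: N; apply: nested_ind.
  exists (fun=> 0); split=> // [X|Z /BD[Z0 _]]; first by rewrite inE.
  by rewrite /finset.cover big_set0 finset.subset0 (negbTE Z0).
move=> N X s nestN XN sX sN' absorb [u [u_ge0 uN' uB]].
set C := finset.cover (N :\ X) in sN' uB.
have sNB := fintype.subsetP nestN.1; have XB := sNB X XN.
have coverE : finset.cover N = X :|: C by rewrite /finset.cover (big_setD1 X).
have S_gt0 : 0 < #|S|%:R :> R by rewrite ltr0n; apply/card_gt0P; exists s.
(* Such a [t] lies in some [Y] of [N] properly contained in [X], and its weight is at most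
   [eps Y]. *)
have C_le t : t \in X :&: C -> #|S|%:R * u t <= eps X.
  move=> /finset.setIP[tX /finset.bigcupP[Y /[dup] YN' /setD1P[YX YN] tY]].
  have uY : u t <= eps Y.
    by rewrite -uN'// (bigD1 t)//= lerDl sumr_ge0.
  apply: le_trans (epsS X Y XB (sNB Y YN) _).
    by rewrite ler_pM2l.
  apply: proper_card; rewrite finset.properEneq YX /=.
  apply: absorb; [exact: sNB|exact: sub_cover|].
  by apply/set0Pn; exists t; rewrite inE tY.
pose d : R := #|X :\: C|%:R.
have d_gt0 : 0 < d.
  by rewrite ltr0n; apply/card_gt0P; exists s; rewrite inE sN' sX.
(* The slack that [X] leaves after its proper subsets in [N] is shared evenly among
   the points of [X] they do not cover; lacunarity of [eps] makes each share [c] at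
   least [eps Z] for every smaller [Z]. *)
pose c := (eps X - \sum_(t in X :&: C) u t) / d.
have c_ge e : #|S|%:R * e <= eps X -> e <= c.
  move=> le_e; rewrite ler_pdivlMr// lerBrDr -(ler_pM2l S_gt0) mulrDr mulrA.
  have le_C : #|S|%:R * \sum_(t in X :&: C) u t <= #|X :&: C|%:R * eps X.
    rewrite mulr_sumr mulr_natl -[leRHS]sumr_const; apply: ler_sum => t; exact: C_le.
  have le_d : #|S|%:R * e * d <= d * eps X by rewrite mulrC ler_pM2l.
  apply: le_trans (lerD le_d le_C) _; rewrite -mulrDl -natrD addnC cardsID.
  by rewrite ler_wpM2r ?(ltW (eps_gt0 X XB))// ler_nat max_card.
have c_ge0 : 0 <= c by apply: c_ge; rewrite mulr0 ltW// eps_gt0.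
pose u' t := if t \in X :\: C then c else u t.
have u'_ge0 t : 0 <= u' t by rewrite /u'; case: ifP.
have u'C Z : Z \subset C -> \sum_(t in Z) u' t = \sum_(t in Z) u t.
  move=> sZC; apply: eq_bigr => t tZ.
  by rewrite /u' inE (fintype.subsetP sZC).
have u'X : \sum_(t in X) u' t = eps X.
  rewrite (big_setID C)/= u'C ?finset.subsetIr//.
  rewrite [X in _ + X](eq_bigr (fun=> c)); last by move=> t tXC; rewrite /u' tXC.
  by rewrite sumr_const -mulr_natr -/d divfK ?gt_eqF// addrC subrK.
exists u'; split=> // [Y YN|Z ZB].
  have [->//|YX] := eqVneq Y X.
  have YN' : Y \in N :\ X by rewrite in_setD1 YX.
  by rewrite u'C ?uN'//; exact: sub_cover.
move=> sZ; have [sZC|/fintype.subsetPn[t tZ tC]] := boolP (Z \subset C).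
  by rewrite u'C// uB.
have tX : t \in X.
  by have := fintype.subsetP sZ t tZ; rewrite coverE !inE (negbTE tC) orbF.
have sZX : Z \subset X by apply: absorb => //; apply/set0Pn; exists t; rewrite inE tZ.
have [->|ZX] := eqVneq Z X; first by rewrite u'X.
apply: le_trans (_ : u' t <= _); last by rewrite (bigD1 t)//= lerDl sumr_ge0.
rewrite /u' inE tC tX/=; apply/c_ge/epsS => //.
by apply: proper_card; rewrite finset.properEneq ZX.
Qed.

End NestedSets.

(** The first hypothesis says that [G i] sees only the values before [i], so appending a value does
    not disturb the conditions already met. *)
Lemma exists_seq_pos (R : realType) (G : nat -> (nat -> R) -> R -> Prop) :
  (forall i e e' r, (forall j, (j < i)%N -> e j = e' j) -> G i e r -> G i e' r) ->
  (forall i e, (forall j, (j < i)%N -> 0 < e j) -> exists2 r, 0 < r & G i e r) ->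
  forall m, exists e, forall i, (i < m)%N -> 0 < e i /\ G i e (e i).
Proof.
move=> extG exG; elim=> [|m [e eP]]; first by exists (fun=> 0).
have [|r r_gt0 Gr] := exG m e; first by move=> j /eP[].
pose e' j := if j == m then r else e j.
have e'E i j : (i <= m)%N -> (j < i)%N -> e j = e' j.
  by move=> im ji; rewrite /e' ltn_eqF// (leq_trans ji).
exists e' => i; rewrite ltnS leq_eqVlt => /orP[/eqP->|im].
  by rewrite /e' eqxx; split=> //; apply: extG Gr => j; exact: e'E.
have [e_gt0 Ge] := eP i im; rewrite -(e'E m)//; split=> //.
by apply: extG Ge => j; apply: e'E; exact: ltnW.
Qed.

Lemma face_of_flat (R : realType) (n : nat) (T : finType)
    (a : T -> 'cV[R]_n) (b : T -> R) (I : {set T}) :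
  face_of (poly_of a b) (fun t => flat a b [set t]%SET) I = flat a b I.
Proof.
apply/seteqP; split=> x [Px Ix]; split=> // t tI.
  by apply: (Ix t tI).2; rewrite inE.
by split=> // s; rewrite inE => /eqP->; exact: Ix.
Qed.

(** * The truncation sequence *)

Section SumSlack.
Context {R : realType} {n : nat} {S : finType}.
Variables (a : S -> 'cV[R]_n) (b : S -> R).
Implicit Types (X U : {set S}) (x : 'rV[R]_n).

Local Notation P := (poly_of a b).

Definition height X x : R := \sum_(s in X) slack a b s x.

Lemma heightE X x :
  \sum_(s in X) b s - dot x (\sum_(s in X) a s) = height X x.
Proof. by rewrite /height /slack sumrB dot_sumr. Qed.

Lemma height_ge0 X x : P x -> 0 <= height X x.
Proof. by move=> Px; apply: sumr_ge0. Qed.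

Lemma slack_le_height X x s : P x -> s \in X -> slack a b s x <= height X x.
Proof.
by move=> Px sX; rewrite /height (bigD1 s)//= lerDl sumr_ge0// => t _; exact: Px.
Qed.

Lemma flat_height X x : P x -> flat a b X x <-> height X x = 0.
Proof.
move=> Px; split=> [[_ x0]|/eqP]; first by rewrite /height big1.
rewrite psumr_eq0; last by move=> s _; exact: Px.
move=> /allP x0; split=> // s sX; apply/eqP.
by have := x0 s; rewrite mem_index_enum sX => /(_ isT).
Qed.

Lemma sum_normals_neq0 X : indep a X -> X != finset.set0 -> \sum_(s in X) a s != 0.
Proof.
move=> indX /set0Pn[s sX]; have [v vX] := indX (fun=> 1); apply/eqP => aX0.
have : dot v (\sum_(s in X) a s) = #|X|%:R.
  by rewrite dot_sumr (eq_bigr (fun=> 1)) ?sumr_const.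
by move/eqP; rewrite aX0 dot0r eq_sym pnatr_eq0 cards_eq0 => /eqP X0; rewrite X0 inE in sX.
Qed.

(** Small slacks can be prescribed on [U], while the lower bound off [U] secures the cuts of all
    sets not contained in [U]. *)
Definition flats_realized (e : R) : Prop :=
  forall U, flat a b U !=set0 -> forall y : S -> R, (forall s, 0 <= y s <= e) ->
  exists x, (forall s, s \in U -> slack a b s x = y s) /\
            (forall s, s \notin U -> e <= slack a b s x).

(** Nonempty flats are handled by [near_flat]. If [flat a b U] is empty, [height U] is positive on
    [P], and [flat_gap] bounds it away from 0. *)
Lemma exists_scale : (forall x, P x -> indep a (active a b x)) ->
  exists2 e : R, 0 < e & flats_realized e /\
    (forall U, ~ (flat a b U !=set0) -> forall x, P x -> e <= height U x).
Proof.
move=> indP.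
have [e e_gt0 /(_ e)] : exists2 e0 : R, 0 < e0 & forall e, 0 < e <= e0 -> forall U,
    (flat a b U !=set0 -> forall y : S -> R, (forall s, 0 <= y s <= e) ->
       exists x, (forall s, s \in U -> slack a b s x = y s) /\
                 (forall s, s \notin U -> e <= slack a b s x)) /\
    (~ (flat a b U !=set0) -> forall x, P x -> e <= height U x).
  apply: exists_pos_fin => U.
  have [[x Ux]|noU] := pselect (flat a b U !=set0).
    have [e0 e0_gt0 e0P] := near_flat Ux.1 (indP x Ux.1) (flat_activeP Ux).
    by exists e0 => // e le_e; split=> [_|[]]; [exact: e0P|exists x].
  have flat0 x : P x -> flat a b finset.set0 x by split=> // s; rewrite inE.
  have [|e0 e0_gt0 e0P] := @flat_gap _ _ _ a b finset.set0
      (\sum_(s in U) a s) (\sum_(s in U) b s).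
    move=> x [Px _]; rewrite -subr_gt0 heightE lt_def height_ge0// andbT.
    by apply/eqP => /(flat_height _ Px) Ux; apply: noU; exists x.
  exists e0 => // e le_e; split=> // _ x Px.
  by have := e0P e le_e x (flat0 x Px); rewrite -heightE; lra.
rewrite e_gt0 lexx => /(_ isT) eP; exists e => //.
by split=> U; [exact: (eP U).1|exact: (eP U).2].
Qed.

End SumSlack.

Section Truncations.
Context {R : realType} {n : nat} {S : finType}.
Variables (a : S -> 'cV[R]_n) (b : S -> R) (B : {set {set S}}).

Local Notation P := (poly_of a b).
Local Notation D := [set I | flat a b I !=set0].
Local Notation height := (height a b).

Hypotheses (P_neq0 : P !=set0) (indP : forall x, P x -> indep a (active a b x)).
Hypothesis hB : building_set D B.
Implicit Types (X Y Z : {set S}) (N : {set {set S}}) (x : 'rV[R]_n).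

Let D0 : D finset.set0.
Proof. by have [x Px] := P_neq0; exists x; split=> // s; rewrite inE. Qed.

Let DS X Y : X \subset Y -> D Y -> D X.
Proof.
move=> /fintype.subsetP sXY [x [Px x0]]; exists x; split=> // s /sXY; exact: x0.
Qed.

Let indD X : D X -> indep a X.
Proof. by move=> [x Xx]; apply: indepS (flat_activeP Xx) _; exact: indP Xx.1. Qed.

Lemma sum_normals_building_neq0 X : X \in B -> \sum_(s in X) a s != 0.
Proof.
by case: hB => BD _ _ /BD[X0 DX]; apply: sum_normals_neq0 => //; exact: indD.
Qed.

(** * The polyhedron of all cuts and its nested complex *)

Section Nestohedron.
Variables (eta K : R) (eps : {set S} -> R).
(** [K] is the ratio between successive scales: at least [#|S|] for [nested_weights], and above the
    number of subsets of [S] to bound sums over an antichain. *)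
Hypotheses (K_S : #|S|%:R <= K) (K_B : #|{: {set S}}|%:R < K).
Hypothesis eta_gt0 : 0 < eta.
Hypothesis near : flats_realized a b eta.
Hypothesis gap : forall X, ~ D X -> forall x, P x -> eta <= height X x.
Hypothesis eps_gt0 : forall X, X \in B -> 0 < eps X.
Hypothesis eps_eta : forall X, X \in B -> K * eps X <= eta.
Hypothesis epsS : forall X Y, X \in B -> Y \in B -> (#|Y| < #|X|)%N ->
  K * eps Y <= eps X.

Local Notation T := {X : {set S} | X \in B}.

Definition cut_normal (t : T) : 'cV[R]_n := \sum_(s in val t) a s.
Definition cut_level (t : T) : R := \sum_(s in val t) b s - eps (val t).

Local Notation Q := (poly_of cut_normal cut_level).

Lemma cut_slack t x :
  slack cut_normal cut_level t x = height (val t) x - eps (val t).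
Proof. by rewrite -heightE /slack /cut_level addrAC. Qed.

(** The inequalities of [P] follow from the cuts of singletons, which belong to [B]. *)
Lemma cut_polyE : Q = [set x | P x /\ forall X, X \in B -> eps X <= height X x].
Proof.
case: hB => _ B1 _; apply/seteqP; split=> x.
  move=> Qx; have xB X : X \in B -> eps X <= height X x.
    by move=> XB; have := Qx (exist _ X XB); rewrite cut_slack/= subr_ge0.
  split=> // s; apply: ltW; apply: lt_le_trans (eps_gt0 (B1 s)) _.
  by apply: le_trans (xB _ (B1 s)) _; rewrite /height big_set1.
by move=> [_ xB] t; rewrite cut_slack subr_ge0 xB// (valP t).
Qed.

Lemma nested_tight x N : Q x -> N \subset B ->
  (forall X, X \in N -> height X x = eps X) -> nested D B N.
Proof.
rewrite cut_polyE => -[Px Bx] sNB Nx; split=> // A sAN leA antiA.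
have AB X : X \in A -> X \in B by move=> /(fintype.subsetP sAN)/(fintype.subsetP sNB).
have K_gt0 : 0 < K by rewrite (le_lt_trans _ K_B).
(* The sum of the heights over [A] counts each point of the cover at least once, and has fewer than
   [K] terms, each at most [e / K]. *)
have height_cover e : 0 < e -> (forall X, X \in A -> K * eps X <= e) ->
    height (finset.cover A) x < e.
  move=> e_gt0 Ae; rewrite -(ltr_pM2l K_gt0).
  apply: (@le_lt_trans _ _ (\sum_(X in A) K * eps X)).
    rewrite -mulr_sumr ler_pM2l//.
    rewrite (eq_bigr (fun X => height X x)); last first.
      by move=> X XA; rewrite Nx// (fintype.subsetP sAN).
    rewrite /height (exchange_big_dep (mem (finset.cover A)))/=; last first.
      by move=> X s XA sX; apply/finset.bigcupP; exists X.
    apply: ler_sum => s /finset.bigcupP[X XA sX].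
    by rewrite (bigD1 X)/= ?XA// lerDl sumr_ge0// => Y _; exact: Px.
  apply: (@le_lt_trans _ _ (\sum_(X in A) e)); first exact: ler_sum.
  rewrite sumr_const -mulr_natl ltr_pM2r//; apply: le_lt_trans K_B.
  by rewrite ler_nat max_card.
have [DA|nDA] := pselect (D (finset.cover A)); last first.
  have [X XA] : exists X, X \in A by apply/card_gt0P; exact: ltnW.
  have : height (finset.cover A) x < eta.
    apply: height_cover => [|Y /AB]; last exact: eps_eta.
    by apply: lt_le_trans (eps_eta (AB X XA)); rewrite mulr_gt0// eps_gt0// AB.
  by rewrite ltNge gap.
split=> //; apply/negP => UB.
suff : height (finset.cover A) x < eps (finset.cover A) by rewrite ltNge Bx.
apply: height_cover => [|X XA]; first exact: eps_gt0.
apply: epsS => //; first exact: AB.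
(* If [X] were the whole cover, it would contain another element of the antichain. *)
apply: proper_card; rewrite finset.properEneq sub_cover// andbT.
apply/eqP => XU; move: leA; rewrite (cardD1 X) XA ltnS => /card_gt0P[Y].
rewrite !inE => /andP[YX YA]; have := antiA Y X YA XA YX.
by rewrite [in X in _ \subset X]XU sub_cover.
Qed.

(** Prescribe the slacks on the cover of [N] by [nested_weights]. A [Z] in [B] not inside the cover
    contains a point of slack at least [eta], which exceeds or equals [eps Z]. *)
Lemma nested_realized N : nested D B N ->
  exists2 x, Q x & forall X, X \in N -> height X x = eps X.
Proof.
move=> nestN; case: hB => BD _ _; have sNB := fintype.subsetP nestN.1.
have [|u [u_ge0 uN uB]] := nested_weights D0 hB DS eps_gt0 _ nestN.
  move=> X Y XB YB ltYX; apply: le_trans (epsS XB YB ltYX).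
  by rewrite ler_pM2r// eps_gt0.
have K_ge1 : 1 <= K.
  apply: le_trans (ltW K_B); rewrite ler1n; apply/card_gt0P.
  by exists finset.set0.
have eps_le X : X \in B -> eps X <= eta.
  by move=> XB; apply: le_trans (eps_eta XB); rewrite ler_peMl// ltW// eps_gt0.
pose y s := if s \in finset.cover N then u s else 0.
have [|x [xN xnN]] := @near (finset.cover N) (nested_cover D0 hB nestN) y.
  move=> s; rewrite /y; case: ifP => [|_].
    move=> /finset.bigcupP[X XN sX]; rewrite u_ge0/=.
    apply: le_trans (eps_le X (sNB X XN)); rewrite -uN// (bigD1 s)//=.
    by rewrite lerDl sumr_ge0.
  by rewrite lexx ltW.
have Px : P x.
  move=> s; have [sN|/xnN] := boolP (s \in finset.cover N); last exact/le_trans/ltW.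
  by rewrite xN// /y sN.
have hE Z : Z \subset finset.cover N -> height Z x = \sum_(s in Z) u s.
  move=> /fintype.subsetP sZ; apply: eq_bigr => s /sZ sN.
  by rewrite xN// /y sN.
exists x; last by move=> X XN; rewrite hE ?uN//; exact: sub_cover.
rewrite cut_polyE; split=> // Z ZB.
have [sZ|/fintype.subsetPn[s sZ sN]] := boolP (Z \subset finset.cover N).
  by rewrite hE// uB.
apply: le_trans (eps_le Z ZB) _; apply: le_trans (xnN s sN) _.
exact: slack_le_height.
Qed.

Let tight x : {set {set S}} := [set val t | t in active cut_normal cut_level x]%SET.

Let tightP x : Q x -> nested D B (tight x).
Proof.
move=> Qx; apply: (nested_tight Qx).
  by apply/fintype.subsetP => _ /imsetP[t _ ->]; exact: valP.
move=> _ /imsetP[t + ->]; rewrite inE cut_slack subr_eq0 => /eqP.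
exact.
Qed.

(** Two systems are solved in turn: unimodularity of the nested incidence matrix gives values on
    single points, and independence of the normals [a s] on the cover gives a vector with these
    values. *)
Lemma cut_indep x : Q x -> indep cut_normal (active cut_normal cut_level x).
Proof.
move=> Qx y; have nestN := tightP Qx.
pose z X := if insub X is Some t then y t else 0.
have [u uN] := nested_unimodular D0 hB DS z nestN.
have [v vN] := indD (nested_cover D0 hB nestN) u.
exists v => t tx; have tN : val t \in tight x by apply: imset_f.
have -> : y t = z (val t) by rewrite /z valK.
rewrite -uN// dot_sumr; apply: eq_bigr => s st; apply: vN.
by apply: (fintype.subsetP (sub_cover tN)).
Qed.

Lemma cut_flatP (I : {set T}) :
  flat cut_normal cut_level I !=set0 <-> nested D B (val @: I).
Proof.
split=> [[x Ix]|/nested_realized[x Qx xI]].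
  apply: nestedS (tightP Ix.1); apply: imsetS; exact: flat_activeP Ix.
exists x; split=> // t tI; rewrite cut_slack xI ?subrr//; exact: imset_f.
Qed.

Lemma nested1 X : X \in B -> nested D B [set X]%SET.
Proof.
move=> XB; split=> [|A /subset_leq_card]; first by rewrite finset.sub1set.
by rewrite cards1 => + leA; rewrite leqNgt leA.
Qed.

(** Singletons of [B] are nested, so every cut is tight somewhere. *)
Lemma cut_irredundant : irredundant cut_normal cut_level.
Proof.
have nest0 : nested D B (val @: (finset.set0 : {set T})).
  rewrite imset0; split=> [|A]; first exact: finset.sub0set.
  by rewrite finset.subset0 => /eqP->; rewrite cards0.
apply: indep_irredundant; last 1 first.
- move=> t; have /cut_flatP[x tx] : nested D B (val @: [set t]%SET).
    by rewrite imset_set1; apply: nested1; exact: valP.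
  by exists x; [exact: tx.1|rewrite -finset.sub1set; exact: flat_activeP tx].
- by have /cut_flatP[x [Qx _]] := nest0; exists x.
- exact: cut_indep.
Qed.

Lemma cut_nestohedron : nestohedron D B Q.
Proof.
have irr := cut_irredundant.
split; first by apply/(simple_polyhedronE irr) => x; exact: cut_indep.
exists T, (fun t => flat cut_normal cut_level [set t]%SET); split.
  rewrite /facet_indexing facetsE//; split=> [t _|t u _ _|_ [t _ <-]].
  - by exists t.
  - exact: flat1_inj.
  - by exists t.
have dualE : dual_complex Q (fun t => flat cut_normal cut_level [set t]%SET) =
    [set I | flat cut_normal cut_level I !=set0].
  by apply: funext => I; rewrite /dual_complex/= face_of_flat.
exists val; rewrite dualE; split; last by move=> I _; exact: cut_flatP.
split=> [t _|t u _ _|X [N nestN /= XN]].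
- exists [set val t]%SET; last by rewrite /= inE.
  by apply: nested1; exact: valP.
- exact: val_inj.
- have XB : X \in B by apply: (fintype.subsetP nestN.1).
  exists (exist _ X XB) => //; exists [set (exist _ X XB)]%SET; last by rewrite /= inE.
  by apply/cut_flatP; rewrite imset_set1; exact: nested1.
Qed.

End Nestohedron.

(** * Truncating one face at a time *)

Section Sequence.
Context (l : seq {set S}) (l_uniq : uniq l) (l_B : l =i B).
Hypothesis l_sorted : sorted (fun X Y : {set S} => (#|Y| <= #|X|)%N) l.

Local Notation nthl := (nth finset.set0 l).

Definition stage (e : nat -> R) (i : nat) : set 'rV[R]_n :=
  [set x | P x /\ forall j, (j < i)%N -> e j <= height (nthl j) x].

Definition stage_normal i (t : S + 'I_i) : 'cV[R]_n :=
  match t with inl s => a s | inr j => \sum_(s in nthl j) a s end.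

Definition stage_level (e : nat -> R) i (t : S + 'I_i) : R :=
  match t with inl s => b s | inr j => \sum_(s in nthl j) b s - e j end.

Lemma stageE e i : stage e i = poly_of (@stage_normal i) (@stage_level e i).
Proof.
apply/seteqP; split=> x.
  move=> [Px ex] [s|j]; first exact: Px.
  by rewrite /slack /= addrAC heightE subr_ge0 ex.
move=> Qx; split=> [s|j ji]; first exact: (Qx (inl s)).
by have := Qx (inr (Ordinal ji)); rewrite /slack /= addrAC heightE subr_ge0.
Qed.

Lemma stage_ext e e' i : (forall j, (j < i)%N -> e j = e' j) -> stage e i = stage e' i.
Proof.
move=> ee'; apply/seteqP; split=> x [Px ex]; split=> // j ji; have := ex j ji.
all: by rewrite ee'.
Qed.

Lemma stageS e i : stage e i.+1 = stage e i `&`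
  halfspace_le (\sum_(s in nthl i) a s) (\sum_(s in nthl i) b s - e i).
Proof.
have heE x : halfspace_le (\sum_(s in nthl i) a s) (\sum_(s in nthl i) b s - e i) x
    <-> e i <= height (nthl i) x.
  by rewrite -heightE /halfspace_le /= -/(dot _ _) !lerBrDr addrC.
apply/seteqP; split=> x.
  move=> [Px ex]; split; last by apply/heE/ex.
  by split=> // j ji; apply: ex; exact: ltnW.
move=> [[Px ex] /heE exi]; split=> // j.
by rewrite ltnS leq_eqVlt => /orP[/eqP->|/ex].
Qed.

Lemma stage_face e i :
  flat a b (nthl i) `&` stage e i =
  stage e i `&` hyperplane (\sum_(s in nthl i) a s) (\sum_(s in nthl i) b s).
Proof.
have hypE x : hyperplane (\sum_(s in nthl i) a s) (\sum_(s in nthl i) b s) x <->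
    height (nthl i) x = 0.
  rewrite -heightE /hyperplane /= -/(dot _ _).
  by split=> [->|/eqP]; rewrite ?subrr// subr_eq0 => /eqP.
apply/seteqP; split=> x [].
  by move=> + Qx; split=> //; apply/hypE/(flat_height _ Qx.1).
by move=> Qx /hypE; split=> //; apply/(flat_height _ Qx.1).
Qed.

Lemma nth_building i : (i < size l)%N -> nthl i \in B.
Proof. by move=> il; rewrite -l_B mem_nth. Qed.

Lemma leq_card_nth i j : (i <= j)%N -> (j < size l)%N -> (#|nthl j| <= #|nthl i|)%N.
Proof.
move=> ij jl.
have trans : transitive (fun X Y : {set S} => (#|Y| <= #|X|)%N).
  by move=> Y X Z XY YZ; exact: leq_trans YZ XY.
apply: (sorted_leq_nth trans _ finset.set0 l_sorted) => //; rewrite inE//.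
exact: leq_ltn_trans jl.
Qed.

(** The order matters here: an earlier set is distinct and at least as large, so it has a point
    outside the current set. Where the current slacks vanish and all others are at least [eta], the
    earlier cuts therefore hold. *)
Lemma stage_face_neq0 (e : nat -> R) (eta : R) i : 0 < eta ->
  flats_realized a b eta -> (forall j, (j < size l)%N -> e j <= eta) -> (i < size l)%N ->
  flat a b (nthl i) `&` stage e i !=set0.
Proof.
move=> eta_gt0 near e_le il; case: hB => BD _ _.
have [_ Di] := BD _ (nth_building il).
have [|x [x0 xn0]] := near _ Di (fun=> 0); first by move=> s; rewrite lexx ltW.
have Px : P x.
  move=> s; have [/x0->//|/xn0] := boolP (s \in nthl i); exact/le_trans/ltW.
exists x; split; first by split.
split=> // j ji; have jl := ltn_trans ji il.
have /fintype.subsetPn[s sj si] : ~~ (nthl j \subset nthl i).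
  apply/negP => sji; have : nthl j == nthl i.
    by rewrite eqEcard sji leq_card_nth// ltnW.
  by rewrite nth_uniq// => /eqP eqji; rewrite eqji ltnn in ji.
apply: le_trans (e_le j jl) _; apply: le_trans (xn0 s si) _.
exact: slack_le_height.
Qed.

Lemma truncation_sequence : exists Q : nat -> set 'rV[R]_n,
  [/\ Q 0%N = P,
      forall i, (i < size l)%N ->
        is_truncation (Q i) (flat a b (nthl i) `&` Q i) (Q i.+1)
    & nestohedron D B (Q (size l))].
Proof.
have [eta eta_gt0 [near gap]] := exists_scale indP.
pose K : R := (#|S| + #|{: {set S}}|).+1%:R.
have K_ge1 : 1 <= K by rewrite ler1n.
have K_gt0 : 0 < K by rewrite ltr0n.
(* The [i]-th level must be small relative to [eta] and to all earlier levels, and must truncate the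
   current stage. *)
pose G i (e : nat -> R) r := [/\ K * r <= eta, forall j, (j < i)%N -> K * r <= e j &
  truncates (stage e i)
    (stage e i `&` hyperplane (\sum_(s in nthl i) a s) (\sum_(s in nthl i) b s))
    (\sum_(s in nthl i) a s) (\sum_(s in nthl i) b s - r)].
have [|i e e_gt0|e eP] := @exists_seq_pos R G _ _ (size l).
- move=> i e e' r ee' [Keta Ke tr]; split=> //.
    by move=> j ji; rewrite -ee' ?Ke.
  by rewrite -(stage_ext ee').
- have [|r0 r0_gt0 r0P] := @exists_truncation _ _ _ (@stage_normal i) (@stage_level e i)
      (\sum_(s in nthl i) a s) (\sum_(s in nthl i) b s).
    by rewrite -stageE => x [Px _]; rewrite -subr_ge0 heightE height_ge0.
  pose r := Order.min r0 (Order.min (eta / K) (\big[Order.min/eta]_(j < i) (e j / K))).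
  have r_gt0 : 0 < r.
    rewrite !lt_min r0_gt0 divr_gt0//= lt_bigmin// => j _.
    by rewrite divr_gt0// e_gt0.
  exists r => //; split.
  - by rewrite mulrC -ler_pdivlMr// !ge_min lexx orbT.
  - move=> j ji; rewrite mulrC -ler_pdivlMr// !ge_min.
    by rewrite (bigmin_le_cond _ (j := Ordinal ji))// !orbT.
  - by rewrite stageE; apply: r0P; rewrite r_gt0 ge_min lexx.
exists (stage e).
have e_eta i : (i < size l)%N -> e i <= eta.
  move=> /eP[ei [Ke _ _]]; apply: le_trans Ke; rewrite ler_peMl// ltW//.
split.
- by apply/seteqP; split=> x; [case|split].
- move=> i il; have [ei [_ _ tr]] := eP i il; split.
  + rewrite stageE; apply: polyhedron_poly_of => -[s|j] /=.
      have [_ B1 _] := hB; have := sum_normals_building_neq0 (B1 s).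
      by rewrite big_set1.
    apply: sum_normals_building_neq0; apply: nth_building.
    exact: ltn_trans il.
  + rewrite stage_face; exists (\sum_(s in nthl i) a s), (\sum_(s in nthl i) b s).
    split=> // x [Px _]; rewrite /halfspace_le /= -/(dot _ _) -subr_ge0 heightE.
    exact: height_ge0.
  + exact: (stage_face_neq0 eta_gt0).
  + rewrite stage_face; exists (\sum_(s in nthl i) a s), (\sum_(s in nthl i) b s - e i).
    by split=> //; exact: stageS.
- pose eps X := e (index X l).
  have indexl X : X \in B -> (index X l < size l)%N by rewrite index_mem l_B.
  have eps_gt0 X : X \in B -> 0 < eps X by move=> /indexl/eP[].
  have stage_last : stage e (size l) = poly_of (@cut_normal) (cut_level eps).
    rewrite cut_polyE//; apply/seteqP; split=> x [Px ex]; split=> //.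
      by move=> X XB; have := ex _ (indexl X XB); rewrite nth_index// l_B.
    by move=> j jl; have := ex _ (nth_building jl); rewrite /eps index_uniq.
  rewrite stage_last; apply: (cut_nestohedron (eta := eta) (K := K)) => //.
  + by rewrite ler_nat leqW// leq_addr.
  + by rewrite ltr_nat ltnS leq_addl.
  + by move=> X /indexl/eP[_ []].
  + move=> X Y XB YB ltYX; have [_ [_ Ke _]] := eP _ (indexl Y YB); apply: Ke.
    (* The smaller set [Y] is listed after [X], so its level was chosen relative to that of [X]. *)
    rewrite ltnNge; apply/negP => leYX.
    have := leq_card_nth leYX (indexl X XB).
    by rewrite !nth_index ?l_B// leqNgt ltYX.
Qed.

End Sequence.
End Truncations.

Theorem theorem2p3p11 (R : realType) (n : nat) (P : set 'rV[R]_n)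
  (S : finType) (F : S -> set 'rV[R]_n) (B : {set {set S}})
  (hP : simple_polyhedron P) (hF : facet_indexing P F)
  (hB : building_set (dual_complex P F) B)
  (l : seq {set S}) (l_uniq : uniq l) (l_B : l =i B)
  (l_sorted : sorted (fun X Y : {set S} => (#|Y| <= #|X|)%N) l) :
  exists Q : nat -> set 'rV[R]_n,
    [/\ Q 0%N = P,
        forall i, (i < size l)%N ->
          is_truncation (Q i) (face_of P F (nth finset.set0 l i) `&` Q i)
            (Q i.+1)
      & nestohedron (dual_complex P F) B (Q (size l))].
Proof.
have [a [b [PE FE indP]]] := facet_system hP hF.
have P_neq0 : P !=set0 by case: hP => _ [x [V [Px _ _ _]]] _; exists x.
have faceE I : face_of P F I = flat a b I.
  by rewrite -face_of_flat -PE; congr face_of; apply: funext.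
have dualE : dual_complex P F = [set I | flat a b I !=set0].
  by apply: funext => I; rewrite /dual_complex /= faceE.
rewrite dualE in hB *; rewrite PE in P_neq0 indP.
have [Q [Q0 Qtr Qnest]] := truncation_sequence P_neq0 indP hB l_uniq l_B l_sorted.
by exists Q; split=> // [|i il]; rewrite ?faceE ?PE//; exact: Qtr.
Qed.
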